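(* Let $n\ge 1$. Every $n$-qubit stabilizer unitary can be executed as a circuit over the gate library $\{\mathrm{H},\mathrm{P},\mathrm{CNOT}\}$ in the Linear Nearest Neighbor architecture with two-qubit gate depth at most $14n-4$.
   Context: The gates are the Hadamard gate $\mathrm{H}=\frac{1}{\sqrt2}\begin{pmatrix}1&1\\1&-1\end{pmatrix}$, the Phase gate $\mathrm{P}=\mathrm{diag}(1,i)$ and the controlled-NOT gate $\mathrm{CNOT}$. An $n$-qubit stabilizer unitary is a unitary computed by a circuit on $n$ qubits composed of $\mathrm{H}$, $\mathrm{P}$ and $\mathrm{CNOT}$ gates, each allowed to act on any qubit (resp. any ordered pair of distinct qubits). In the Linear Nearest Neighbor (LNN) architecture the qubits $1,\dots,n$ are arranged on a line and a two-qubit gate may act only on neighboring qubits $j,j+1$ (either one may be the control). The two-qubit gate depth of a circuit is the number of layers of two-qubit gates, where gates within a layer act on pairwise disjoint qubits; single-qubit gates may be interleaved freely between these layers and are not counted. *)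

(* Defs.v *)
From HB Require Import structures.
From mathcomp Require Import all_boot all_order all_algebra.
Set Implicit Arguments.
Unset Strict Implicit.
Unset Printing Implicit Defensive.
Import Order.TTheory GRing.Theory Num.Theory.

Local Open Scope ring_scope.

(* Labels of the computational basis of n qubits. *)
Definition bits (n : nat) := {ffun 'I_n -> bool}.

(* Operators on n qubits, as matrices in the computational basis: row and     *)
(* column indices range over the 2 ^ n bit strings through enum_val.          *)
Notation "''Op[' C ]_ n" := 'M[C]_#|{: bits n}|
  (at level 8, n at level 2, format "''Op[' C ]_ n") : type_scope.

Lemma card_bits (n : nat) : #|{: bits n}| = (2 ^ n)%N.
Proof. by rewrite card_ffun card_bool card_ord. Qed.

Section Gates.
Variables (C : numClosedFieldType) (n : nat).

(* 2 x 2 matrices have rows and columns indexed by bool (false = 0).          *)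
Definition hadamard (a b : bool) : C := (-1) ^+ (a && b) / sqrtC 2.
Definition phase (a b : bool) : C := if a == b then 'i ^+ a else 0.

(* A on qubit q, tensored with the identity on the other qubits. *)
Definition on_qubit (q : 'I_n) (A : bool -> bool -> C) : 'Op[C]_n :=
  \matrix_(i, j) let x : bits n := enum_val i in
    let y : bits n := enum_val j in
    if [forall r : 'I_n, (r != q) ==> (x r == y r)] then A (x q) (y q) else 0.

Definition cnot_bits (c t : 'I_n) (x : bits n) : bits n :=
  [ffun r => if r == t then x t (+) x c else x r].

(* Column y has its only 1 in row cnot_bits c t y. *)
Definition cnot_mx (c t : 'I_n) : 'Op[C]_n :=
  \matrix_(i, j) (enum_val i == cnot_bits c t (enum_val j) :> bits n)%:R.

End Gates.

Inductive gate (n : nat) : Type :=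
| GateH (q : 'I_n)
| GateP (q : 'I_n)
| GateCNOT (control target : 'I_n) of control != target.

Definition gate_mx (C : numClosedFieldType) (n : nat) (g : gate n) : 'Op[C]_n :=
  match g with
  | GateH q => on_qubit q (@hadamard C)
  | GateP q => on_qubit q (@phase C)
  | GateCNOT c t _ => cnot_mx C c t
  end.

Definition circuit (n : nat) := seq (gate n).

(* The head of the list acts first, so it is the rightmost factor. *)
Fixpoint circuit_mx (C : numClosedFieldType) (n : nat) (c : circuit n) :
    'Op[C]_n :=
  if c is g :: c' then circuit_mx C c' *m gate_mx C g else 1%:M.

(* Equality is exact, not merely up to a global phase. *)
Definition stabilizer_unitary (C : numClosedFieldType) (n : nat)
    (U : 'Op[C]_n) : Prop :=
  exists c : circuit n, circuit_mx C c = U.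

Section Layout.
Variable n : nat.
Implicit Types (g : gate n) (c L : circuit n).

Definition gate_support g : {set 'I_n} :=
  match g with
  | GateH q | GateP q => [set q]
  | GateCNOT c t _ => [set c; t]
  end.

Definition is_two_qubit g : bool :=
  if g is GateCNOT _ _ _ then true else false.

Definition lnn_gate g : bool :=
  if g is GateCNOT c t _ then (c.+1 == t :> nat) || (t.+1 == c :> nat)
  else true.

Definition lnn c : bool := all lnn_gate c.

Definition two_qubit_layer L : bool :=
  all is_two_qubit L &&
  pairwise (fun g h => [disjoint gate_support g & gate_support h]) L.

(* layered c d: the list c reads as d layers of two-qubit gates with any      *)
(* single-qubit gates before, between and after them.                         *)
Inductive layered : circuit n -> nat -> Prop :=
| LayeredNil : layered [::] 0
| LayeredSingle g c d :
    ~~ is_two_qubit g -> layered c d -> layered (g :: c) d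
| LayeredTwo L c d :
    two_qubit_layer L -> layered c d -> layered (L ++ c) d.+1.

(* Listing the gates of a circuit layer by layer only permutes gates acting   *)
(* on disjoint qubits, so nothing is lost by reading layers off the list.     *)
Definition two_qubit_depth_le c (D : nat) : Prop :=
  exists2 d : nat, layered c d & (d <= D)%N.

End Layout.

(* Main.v *)
(* A Clifford circuit acts on Pauli labels in F_2^(2n) by symplectic maps.     *)
(* Starting from the inverse of U, the images of X_k and Z_k are restored for *)
(* k = n-1, ..., 0: a staircase of boxes on the pairs (0,1), ..., (k-1,k)     *)
(* pushes the image of X_k onto qubit k, and a second one then pushes the     *)
(* image of Z_k there without disturbing X_k. A box needs at most two CNOTs,  *)
(* and consecutive staircases overlap in time with a delay of four layers, so *)
(* the 2n staircases fit in 10n - 1 layers. What remains is a Pauli operator  *)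
(* times a scalar u. The scalar has modulus 1 and lies in Z[i, 1/sqrt 2],     *)
(* hence is a power of omega = (1 + i)/sqrt 2, and omega I = (HP)^3 on any    *)
(* one qubit, so both factors cost single-qubit gates only.                   *)
Require Import Defs.
From HB Require Import structures.
From mathcomp Require Import all_boot all_order all_algebra.
From mathcomp Require Import ring zify.
Set Implicit Arguments.
Unset Strict Implicit.
Unset Printing Implicit Defensive.
Import Order.TTheory GRing.Theory Num.Theory.

Local Open Scope ring_scope.

(** Up to phase a Pauli operator is a vector of F_2^(2n), a [label]. A circuit moves Paulis through
    [acts] ([circuit_pauli]), and [acts] preserves the symplectic form, that is, anticommutation
    ([symp_acts]). Suppose gates [w] appended to a circuit for the inverse of U bring every X_k and
    Z_k back to itself. The product then commutes with each of them up to a sign. Pauli gates remove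
    the signs ([correct_signs]), and an operator commuting with all X_k and Z_k is scalar
    ([pauli_centralizer]). Hence [w] with the Pauli gates computes U up to a scalar, which
    [scalar_circuit] identifies and [omega_circuit] cancels.

    Qubits are restored from last to first. A restored qubit j determines coordinate j of every
    image ([fixes_coord]), so the images of the remaining X_k and Z_k live on qubits 0, ..., k, and
    the staircases of [fix_qubit] never reach a restored qubit.

    For the depth, [delays] records when each qubit becomes free. A profile bounded by B + 2q
    becomes one bounded by B + 4 + 2q after a staircase. Two staircases per qubit give at most 8n +
    2(n - 1) = 10n - 2 ([fix_qubits]), and [schedule] turns this into 10n - 1 layers. *)

(** * Product operators, gate matrices, commutation and inverses *)

Section Operators.
Variables (C : numClosedFieldType) (n : nat).
Implicit Types (A B : bool -> bool -> C) (F G : 'I_n -> bool -> bool -> C).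
Implicit Types (M N : 'Op[C]_n) (x y z : bits n) (q r c t : 'I_n).

Definition entry M x y : C := M (enum_rank x) (enum_rank y).

Lemma entryP M N : (forall x y, entry M x y = entry N x y) -> M = N.
Proof.
move=> eqMN; apply/matrixP=> i j.
by have := eqMN (enum_val i) (enum_val j); rewrite /entry !enum_valK.
Qed.

Lemma entry_mul M N x y :
  entry (M *m N) x y = \sum_z entry M x z * entry N z y.
Proof.
rewrite /entry mxE (reindex (@enum_rank {: bits n})) //=.
by exists enum_val => i _; rewrite ?enum_rankK ?enum_valK.
Qed.

Lemma entry_scalar a x y : entry a%:M x y = a *+ (x == y).
Proof. by rewrite /entry mxE (inj_eq enum_rank_inj). Qed.

Lemma entry_scale a M x y : entry (a *: M) x y = a * entry M x y.
Proof. by rewrite /entry mxE. Qed.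

Definition tensor F : 'Op[C]_n :=
  \matrix_(i, j) \prod_q F q ((enum_val i : bits n) q) ((enum_val j : bits n) q).

Lemma entry_tensor F x y : entry (tensor F) x y = \prod_q F q (x q) (y q).
Proof. by rewrite /entry mxE !enum_rankK. Qed.

Lemma eq_tensor F G : (forall q a b, F q a b = G q a b) -> tensor F = tensor G.
Proof.
by move=> eqFG; apply/entryP=> x y; rewrite !entry_tensor; apply: eq_bigr.
Qed.

Definition mul2 A B a b := A a false * B false b + A a true * B true b.

Definition scal2 (u : C) a b : C := if a == b :> bool then u else 0.

(** A product over the qubits of two-term sums expands into a sum over bit strings, which is the
    matrix product. *)
Lemma tensor_mul F G :
  tensor F *m tensor G = tensor (fun q => mul2 (F q) (G q)).
Proof.
apply/entryP=> x y; rewrite entry_mul entry_tensor.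
under [RHS]eq_bigr => q _.
  rewrite (_ : mul2 _ _ _ _ = \sum_b F q (x q) b * G q b (y q)); last first.
    by rewrite big_bool /mul2 addrC.
  over.
rewrite bigA_distr_bigA /=; apply: eq_bigr => z _.
by rewrite !entry_tensor big_split.
Qed.

Lemma tensorZ (u : 'I_n -> C) F :
  tensor (fun q a b => u q * F q a b) = (\prod_q u q) *: tensor F.
Proof.
by apply/entryP=> x y; rewrite entry_scale !entry_tensor big_split.
Qed.

Definition at_qubit q A r : bool -> bool -> C :=
  if r == q then A else scal2 1.

Lemma on_qubit_tensor q A : on_qubit q A = tensor (at_qubit q A).
Proof.
apply/entryP=> x y; rewrite entry_tensor /entry mxE !enum_rankK /=.
rewrite (bigD1 q) //= {1}/at_qubit eqxx; case: ifPn => [/forallP eqxy|].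
  rewrite big1 ?mulr1 // => r rq; have := eqxy r.
  by rewrite /at_qubit (negPf rq) /scal2 => /= ->.
rewrite negb_forall => /existsP[r]; rewrite negb_imply => /andP[rq xy].
by rewrite (bigD1 r) //= /at_qubit (negPf rq) /scal2 (negPf xy) mul0r mulr0.
Qed.

Lemma tensor_scal2 u q : tensor (at_qubit q (scal2 u)) = u%:M.
Proof.
apply/entryP=> x y; rewrite -on_qubit_tensor entry_scalar.
rewrite /entry mxE !enum_rankK /= /scal2; have [->|neqxy] := eqVneq x y.
  by rewrite eqxx; case: ifPn => // /forallP[] r; rewrite eqxx implybT.
case: ifPn => // /forallP eqxy; case: eqP => // xq.
case/eqP: neqxy; apply/ffunP=> r; have := eqxy r.
by case: (eqVneq r q) => [->|_ /= /eqP].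
Qed.

Lemma on_qubit_mul q A B : on_qubit q A *m on_qubit q B = on_qubit q (mul2 A B).
Proof.
rewrite !on_qubit_tensor tensor_mul; apply: eq_tensor => r a b.
rewrite /at_qubit; case: eqP => // _.
by rewrite /mul2 /scal2; case: a b => [] []; rewrite /= ?mulr0 ?mul0r ?mul1r ?addr0 ?add0r.
Qed.

Lemma on_qubit_scal2 q A u : (forall a b, A a b = scal2 u a b) ->
  on_qubit q A = u%:M.
Proof.
move=> eqA; rewrite on_qubit_tensor -(tensor_scal2 u q); apply: eq_tensor => r a b.
by rewrite /at_qubit; case: eqP.
Qed.

Lemma mul2_scal1 A a b : mul2 A (scal2 1) a b = A a b.
Proof. by rewrite /mul2 /scal2; case: b; rewrite /= ?(mulr0, mulr1, addr0, add0r). Qed.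

Lemma mul2_1scal A a b : mul2 (scal2 1) A a b = A a b.
Proof. by rewrite /mul2 /scal2; case: a; rewrite /= ?(mul0r, mul1r, addr0, add0r). Qed.

Lemma on_qubit_comm q r A B : q != r ->
  on_qubit q A *m on_qubit r B = on_qubit r B *m on_qubit q A.
Proof.
move=> qr; rewrite !on_qubit_tensor !tensor_mul; apply: eq_tensor => s a b.
rewrite /at_qubit; case: (eqVneq s q) => [->|_].
  by rewrite (negPf qr) mul2_scal1 mul2_1scal.
by rewrite mul2_scal1 mul2_1scal.
Qed.

Lemma cnot_bitsK c t : c != t -> involutive (@cnot_bits n c t).
Proof.
move=> ct x; apply/ffunP=> r; rewrite !ffunE eqxx (negPf ct).
by case: eqP => // ->; rewrite addbK.
Qed.

Lemma entry_cnot c t x y : entry (cnot_mx C c t) x y = (x == cnot_bits c t y)%:R.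
Proof. by rewrite /entry mxE !enum_rankK. Qed.

Lemma entry_cnot_mull c t M x y : c != t ->
  entry (cnot_mx C c t *m M) x y = entry M (cnot_bits c t x) y.
Proof.
move=> ct; rewrite entry_mul (bigD1 (cnot_bits c t x)) //= big1 ?addr0.
  by rewrite entry_cnot cnot_bitsK // eqxx mul1r.
move=> z zx; rewrite entry_cnot; case: eqP => [xz|_]; last by rewrite mul0r.
by rewrite xz cnot_bitsK // eqxx in zx.
Qed.

Lemma entry_cnot_mulr c t M x y :
  entry (M *m cnot_mx C c t) x y = entry M x (cnot_bits c t y).
Proof.
rewrite entry_mul (bigD1 (cnot_bits c t y)) //= big1 ?addr0.
  by rewrite entry_cnot eqxx mulr1.
by move=> z /negPf zx; rewrite entry_cnot zx mulr0.
Qed.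

Lemma on_qubit_cnot_comm q c t A : c != t -> q != c -> q != t ->
  on_qubit q A *m cnot_mx C c t = cnot_mx C c t *m on_qubit q A.
Proof.
move=> ct qc qt; apply/entryP=> x y; rewrite entry_cnot_mull // entry_cnot_mulr.
rewrite /entry !mxE !enum_rankK /= !ffunE (negPf qt).
congr (if _ then _ else _); apply/forallP/forallP => eqxy r.
- have := eqxy c; have := eqxy r; have := eqxy t.
  rewrite !ffunE eqxx (negPf ct) !(eq_sym _ q) qc qt /= => /eqP -> + /eqP ->.
  case: (eqVneq r t) => [-> _|//]; by rewrite addbK eqxx implybT.
- have := eqxy c; have := eqxy r; have := eqxy t.
  rewrite !ffunE eqxx (negPf ct) !(eq_sym _ q) qc qt /= => /eqP <- + /eqP <-.
  case: (eqVneq r t) => [-> _|//]; by rewrite addbK eqxx implybT.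
Qed.

Lemma cnot_comm c t (c' t' : 'I_n) : c != t -> c' != t' -> [disjoint [set c; t] & [set c'; t']] ->
  cnot_mx C c t *m cnot_mx C c' t' = cnot_mx C c' t' *m cnot_mx C c t.
Proof.
move=> ct ct' dis; apply/entryP=> x y; rewrite !entry_cnot_mull // !entry_cnot.
have neq a b : a \in [set c; t] -> b \in [set c'; t'] -> a != b.
  by move=> ain bin; apply: contraTneq ain => ->; rewrite (disjointFl dis).
have cc' : c != c' by apply: neq; rewrite !inE eqxx ?orbT.
have tc' : t != c' by apply: neq; rewrite !inE eqxx ?orbT.
have c't : c' != t by rewrite eq_sym.
have tt' : t != t' by apply: neq; rewrite !inE eqxx ?orbT.
have ct'' : c != t' by apply: neq; rewrite !inE eqxx ?orbT.
congr (nat_of_bool _)%:R.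
rewrite -(inj_eq (inv_inj (cnot_bitsK ct))) cnot_bitsK //.
rewrite -[RHS](inj_eq (inv_inj (cnot_bitsK ct'))) cnot_bitsK // (eq_sym x) [RHS](eq_sym x).
congr (_ == _); apply/ffunP=> r; rewrite !ffunE (negPf c't) (negPf ct'').
rewrite (negPf tt') (eq_sym t') (negPf tt').
by case: (eqVneq r t) => // ->; rewrite (negPf tt').
Qed.

Lemma gate_comm (g h : gate n) : [disjoint gate_support g & gate_support h] ->
  gate_mx C g *m gate_mx C h = gate_mx C h *m gate_mx C g.
Proof.
have single q r : [disjoint [set q] & [set r]] -> q != r.
  by rewrite disjoints1 inE.
have double q c t : [disjoint [set q] & [set c; t]] -> (q != c) /\ (q != t).
  by rewrite disjoints1 !inE negb_or => /andP.
case: g h => [q|q|c t ct] [r|r|c' t' ct'] /=;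
  try by move/single; apply: on_qubit_comm.
- by case/double=> *; apply: on_qubit_cnot_comm.
- by case/double=> *; apply: on_qubit_cnot_comm.
- by rewrite disjoint_sym; case/double=> *; apply/esym/on_qubit_cnot_comm.
- by rewrite disjoint_sym; case/double=> *; apply/esym/on_qubit_cnot_comm.
- exact: cnot_comm.
Qed.

Lemma circuit_mx_cat (c d : circuit n) :
  circuit_mx C (c ++ d) = circuit_mx C d *m circuit_mx C c.
Proof. by elim: c => [|g c IH] /=; rewrite ?mulmx1 // IH mulmxA. Qed.

Lemma sqrt2_neq0 : sqrtC 2 != 0 :> C.
Proof. by rewrite sqrtC_eq0 pnatr_eq0. Qed.

Lemma sqrt2V : (sqrtC 2)^-1 = sqrtC 2 / 2 :> C.
Proof. by apply: (mulfI sqrt2_neq0); rewrite mulfV ?sqrt2_neq0 // mulrA -expr2 sqrtCK divff ?pnatr_eq0. Qed.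

Lemma phase_sqr a b : mul2 (@phase C) (@phase C) a b = if a == b then (-1) ^+ a else 0.
Proof.
rewrite /mul2 /phase; have i2 : 'i * 'i = -1 :> C by rewrite -expr2 sqrCi.
by case: a b => [] []; rewrite /= ?expr1 ?expr0 ?i2 ?(mulr0, mul0r, addr0, add0r, mulr1).
Qed.

(** H and CNOT are involutions and P has order 4, so three copies of any gate invert it and the gate
    set is closed under inverses. *)
Lemma gate_mx_order4 (g : gate n) :
  gate_mx C g *m gate_mx C g *m gate_mx C g *m gate_mx C g = 1%:M.
Proof.
case: g => [q|q|c t ct] /=.
- rewrite !on_qubit_mul; apply: on_qubit_scal2 => a b.
  have := sqrtCK (2 : C); rewrite /mul2 /hadamard /scal2 !sqrt2V.
  by case: a b => [] []; rewrite /= ?expr1 ?expr0 => s2; field: s2.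
- rewrite -mulmxA !on_qubit_mul; apply: on_qubit_scal2 => a b.
  move: phase_sqr; set M := mul2 _ _ => MM; rewrite /mul2 !MM /scal2.
  by case: a b => [] []; rewrite /= ?expr1 ?expr0 ?(mulr0, mul0r, addr0, add0r, mulr1, mulrNN).
- have K : cnot_mx C c t *m cnot_mx C c t = 1%:M.
    by apply/entryP=> x y; rewrite entry_cnot_mull // entry_cnot entry_scalar
       (inj_eq (inv_inj (cnot_bitsK ct))).
  by rewrite K mul1mx K.
Qed.

Lemma inverse_circuit (c : circuit n) :
  exists d : circuit n, circuit_mx C d *m circuit_mx C c = 1%:M.
Proof.
elim: c => [|g c [d dK]]; first by exists [::]; rewrite mulmx1.
exists (d ++ [:: g; g; g]); rewrite circuit_mx_cat /= mul1mx.
by rewrite mulmxA -(mulmxA _ (circuit_mx C d)) dK mulmx1 gate_mx_order4.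
Qed.

End Operators.

Notation pX := (true, false).
Notation pZ := (false, true).
Notation pI := (false, false).

(** * Pauli labels and the symplectic action of gates *)

Section PauliLabels.
Variable n : nat.

(* The label (x, z) on a qubit stands for the Pauli factor X^x Z^z. *)
Definition label := {ffun 'I_n -> bool * bool}.
Implicit Types (p : label) (k q : 'I_n).

Definition pauli_at k (b : bool * bool) : label :=
  [ffun r => if r == k then b else pI].

(* Conjugation by the gate, up to phase. *)
Definition act (g : gate n) (p : label) : label :=
  match g with
  | GateH q => [ffun r => if r == q then ((p r).2, (p r).1) else p r]
  | GateP q => [ffun r => if r == q then ((p r).1, (p r).2 (+) (p r).1) else p r]
  | GateCNOT c t _ =>
    [ffun r => if r == t then ((p t).1 (+) (p c).1, (p t).2)
               else if r == c then ((p c).1, (p c).2 (+) (p t).2) else p r]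
  end.

Definition acts (c : circuit n) (p : label) : label :=
  foldl (fun p g => act g p) p c.

Lemma acts_cat c d p : acts (c ++ d) p = acts d (acts c p).
Proof. exact: foldl_cat. Qed.

(** The symplectic form on F_2^(2n): it is true exactly when the two Paulis anticommute, see
    [pauli_comm]. *)
Definition symp (p p' : label) : bool :=
  \big[addb/false]_k (((p k).1 && (p' k).2) (+) ((p k).2 && (p' k).1)).

Lemma symp_act g p p' : symp (act g p) (act g p') = symp p p'.
Proof.
rewrite /symp; case: g => [q|q|c t ct] /=.
- apply: eq_bigr => k _; rewrite !ffunE; case: eqP => // _ /=.
  by case: (p k) (p' k) => [[] []] [[] []].
- apply: eq_bigr => k _; rewrite !ffunE; case: eqP => // _ /=.
  by case: (p k) (p' k) => [[] []] [[] []].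
- rewrite (bigD1 c) //= (bigD1 t) 1?eq_sym //=.
  rewrite [RHS](bigD1 c) //= [in RHS](bigD1 t) 1?eq_sym //=.
  rewrite !ffunE !eqxx (negPf ct) !addbA.
  congr (_ (+) _); last first.
    by apply: eq_bigr => k /andP[kc kt]; rewrite !ffunE (negPf kc) (negPf kt).
  by case: (p c) (p t) (p' c) (p' t) => [[] []] [[] []] [[] []] [[] []].
Qed.

Lemma symp_acts c p p' : symp (acts c p) (acts c p') = symp p p'.
Proof. by elim: c p p' => //= g c IH p p'; rewrite IH symp_act. Qed.

Lemma symp_pauli_at k b p :
  symp (pauli_at k b) p = (b.1 && (p k).2) (+) (b.2 && (p k).1).
Proof.
rewrite /symp (bigD1 k) //= ffunE eqxx big1 ?addbF // => r /negPf rk.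
by rewrite ffunE rk.
Qed.

Lemma act_id (g : gate n) p : (forall k, k \in gate_support g -> p k = pI) ->
  act g p = p.
Proof.
move=> p0; apply/ffunP=> k; case: g p0 => [q|q|c t ct] /= p0; rewrite ffunE.
- by case: eqP => // ->; rewrite p0 ?inE.
- by case: eqP => // ->; rewrite p0 ?inE.
- rewrite (p0 c) ?(p0 t) ?inE ?eqxx ?orbT //=.
  case: eqP => [->|_]; first by rewrite p0 ?inE ?eqxx ?orbT.
  by case: eqP => // ->; rewrite p0 ?inE ?eqxx ?orbT.
Qed.

Lemma act_notin (g : gate n) p k : k \notin gate_support g -> act g p k = p k.
Proof.
case: g => [q|q|c t ct] /=; rewrite !inE ffunE.
- by move/negPf->.
- by move/negPf->.
- by rewrite negb_or => /andP[/negPf-> /negPf->].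
Qed.

End PauliLabels.

(** * Pauli matrices, conjugation by circuits, and the centralizer *)

Section PauliOperators.
Variables (C : numClosedFieldType) (n : nat).
Implicit Types (M : 'Op[C]_n) (p : label n) (x y z : bits n) (k q : 'I_n).

(** The label (1, 1) gives XZ without the factor i of Y, so its square is -1; phases are tracked
    separately. *)
Definition pauli1 (p : bool * bool) a b : C :=
  if a == b (+) p.1 then (-1) ^+ (p.2 && b) else 0.

Definition pauli p : 'Op[C]_n := tensor (fun q => pauli1 (p q)).

Definition shift p x : bits n := [ffun q => x q (+) (p q).1].

Definition pauli_sign p x : C :=
  (-1) ^+ (\big[addb/false]_q ((p q).2 && x q)).

Lemma prod_sign (b : 'I_n -> bool) :
  \prod_q (-1) ^+ b q = (-1) ^+ (\big[addb/false]_q b q) :> C.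
Proof. by rewrite (big_morph _ (@signr_addb C) (erefl _)). Qed.

Lemma shiftK p : involutive (shift p).
Proof. by move=> x; apply/ffunP=> q; rewrite !ffunE addbK. Qed.

Lemma entry_pauli p x y :
  entry (pauli p) x y = if x == shift p y then pauli_sign p y else 0.
Proof.
rewrite entry_tensor; case: eqP => [->|xy].
  rewrite /pauli_sign -prod_sign; by apply: eq_bigr => q _; rewrite /pauli1 ffunE eqxx.
have /existsP[q xyq] : [exists q, x q != y q (+) (p q).1].
  apply: contra_notT xy; rewrite negb_exists => /forallP xy.
  by apply/ffunP=> q; apply/eqP; rewrite ffunE -[_ == _]negbK xy.
by rewrite (bigD1 q) //= /pauli1 (negPf xyq) mul0r.
Qed.

Lemma entry_pauli_mull p M x y :
  entry (pauli p *m M) x y = pauli_sign p (shift p x) * entry M (shift p x) y.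
Proof.
rewrite entry_mul (bigD1 (shift p x)) //= big1 ?addr0.
  by rewrite entry_pauli shiftK eqxx.
move=> z zx; rewrite entry_pauli; case: eqP => [xz|_]; last by rewrite mul0r.
by rewrite xz shiftK eqxx in zx.
Qed.

Lemma entry_pauli_mulr p M x y :
  entry (M *m pauli p) x y = entry M x (shift p y) * pauli_sign p y.
Proof.
rewrite entry_mul (bigD1 (shift p y)) //= big1 ?addr0.
  by rewrite entry_pauli eqxx.
by move=> z /negPf zx; rewrite entry_pauli zx mulr0.
Qed.

Lemma pauli_comm p p' :
  pauli p *m pauli p' = (-1) ^+ symp p p' *: (pauli p' *m pauli p).
Proof.
rewrite /pauli !tensor_mul /symp -prod_sign -tensorZ; apply: eq_tensor => q a b.
rewrite /mul2 /pauli1.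
by case: (p q) (p' q) a b => [[] []] [[] []] [] [];
  rewrite /= ?expr0 ?expr1 ?(mul0r, mulr0, mul1r, mulr1, addr0, add0r, mulrNN).
Qed.

Lemma on_qubit_pauli q A s p p' :
    (forall r, r != q -> p' r = p r) ->
    (forall a b, mul2 A (pauli1 (p q)) a b = s * mul2 (pauli1 (p' q)) A a b) ->
  on_qubit q A *m pauli p = s *: (pauli p' *m on_qubit q A).
Proof.
move=> pp' eqA; rewrite on_qubit_tensor !tensor_mul.
have -> : s = \prod_r (if r == q then s else 1).
  by rewrite (bigD1 q) //= eqxx big1 ?mulr1 // => r /negPf->.
rewrite -tensorZ; apply: eq_tensor => r a b.
rewrite /at_qubit; case: eqVneq => [->|rq]; first exact: eqA.
by rewrite mul1r mul2_scal1 mul2_1scal pp'.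
Qed.

(** The phase comes from H reversing the order of X and Z, giving a sign on XZ, and from P sending X
    to i XZ. CNOT contributes none. *)
Lemma gate_pauli g p : exists2 s : C, s != 0 &
  gate_mx C g *m pauli p = s *: (pauli (act g p) *m gate_mx C g).
Proof.
case: g => [q|q|c t ct] /=.
- exists ((-1) ^+ ((p q).1 && (p q).2)); first by rewrite signr_eq0.
  apply: on_qubit_pauli => [r /negPf rq|a b]; first by rewrite ffunE rq.
  rewrite ffunE eqxx /mul2 /pauli1 /hadamard.
  by case: (p q) a b => [[] []] [] [];
    rewrite /= ?expr0 ?expr1; ring.
- exists (if (p q).1 then 'i else 1); first by case: ifP; rewrite ?neq0Ci ?oner_eq0.
  apply: on_qubit_pauli => [r /negPf rq|a b]; first by rewrite ffunE rq.
  have i2 : 'i * 'i = -1 :> C by rewrite -expr2 sqrCi.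
  rewrite ffunE eqxx /mul2 /pauli1 /phase.
  case: (p q) a b => [[] []] [] [];
    rewrite /= ?expr0 ?expr1; ring: i2.
- exists 1; rewrite ?oner_eq0 // scale1r; apply/entryP=> x y.
  rewrite entry_cnot_mull // entry_cnot_mulr !entry_tensor.
  rewrite (bigD1 c) //= (bigD1 t) 1?eq_sym //=.
  rewrite [RHS](bigD1 c) //= [in RHS](bigD1 t) 1?eq_sym //=.
  rewrite !ffunE !eqxx (negPf ct) !mulrA.
  congr (_ * _); last first.
    by apply: eq_bigr => k /andP[kc kt]; rewrite !ffunE (negPf kc) (negPf kt).
  rewrite /pauli1.
  by case: (p c) (p t) (x c) (x t) (y c) (y t) => [[] []] [[] []] [] [] [] [];
   rewrite /= ?expr0 ?expr1 ?(mul0r, mulr0, mul1r, mulr1, mulrNN).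
Qed.

Lemma circuit_pauli (c : circuit n) p : exists2 s : C, s != 0 &
  circuit_mx C c *m pauli p = s *: (pauli (acts c p) *m circuit_mx C c).
Proof.
elim: c p => [|g c IH] p /=.
  by exists 1; rewrite ?oner_eq0 // scale1r mul1mx mulmx1.
have [s s0 gE] := gate_pauli g p; have [s' s'0 cE] := IH (act g p).
exists (s * s'); first by rewrite mulf_neq0.
by rewrite -mulmxA gE -scalemxAr [in LHS]mulmxA cE -scalemxAl scalerA mulmxA.
Qed.

Lemma shift_pauli_at k b x :
  shift (pauli_at k b) x = [ffun q => x q (+) ((q == k) && b.1)].
Proof. by apply/ffunP=> q; rewrite !ffunE; case: eqP. Qed.

Lemma pauli_sign_at k b x : pauli_sign (pauli_at k b) x = (-1) ^+ (b.2 && x k).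
Proof.
rewrite /pauli_sign (bigD1 k) //= ffunE eqxx big1 ?addbF // => q /negPf qk.
by rewrite ffunE qk.
Qed.

(** Distinct bit strings differ at some qubit k, and commuting with Z_k makes the corresponding
    entry equal to its opposite, so M is diagonal. Commuting with X_k makes the diagonal invariant
    under flipping bit k, so it is constant. *)
Lemma pauli_centralizer M :
    (forall k, M *m pauli (pauli_at k pX) = pauli (pauli_at k pX) *m M) ->
    (forall k, M *m pauli (pauli_at k pZ) = pauli (pauli_at k pZ) *m M) ->
  exists u, M = u%:M.
Proof.
move=> cX cZ; exists (entry M [ffun=> false] [ffun=> false]).
have offdiag x y : x != y -> entry M x y = 0.
  move=> xy; have /existsP[k xyk] : [exists k, x k != y k].
    apply: contraR xy; rewrite negb_exists => /forallP xy.
    by apply/eqP/ffunP=> q; apply/eqP; rewrite -[_ == _]negbK xy.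
  have := congr1 (fun N => entry N x y) (cZ k).
  rewrite entry_pauli_mull entry_pauli_mulr !pauli_sign_at /= !shift_pauli_at.
  rewrite (_ : [ffun q => x q (+) _] = x); last first.
    by apply/ffunP=> q; rewrite ffunE andbF addbF.
  rewrite (_ : [ffun q => y q (+) _] = y); last first.
    by apply/ffunP=> q; rewrite ffunE andbF addbF.
  rewrite mulrC (_ : y k = ~~ x k); last by case: (x k) (y k) xyk => [] [].
  move/eqP; rewrite signrN mulNr eq_sym -addr_eq0 -mulr2n mulrn_eq0 mulf_eq0.
  by rewrite signr_eq0 => /eqP.
have flip k x : entry M (shift (pauli_at k pX) x)
    (shift (pauli_at k pX) x) = entry M x x.
  have := congr1 (fun N => entry N (shift (pauli_at k pX) x) x)
    (cX k).
  by rewrite entry_pauli_mull entry_pauli_mulr !pauli_sign_at /= shiftK mulr1 mul1r.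
(* Induction on the number of ones, erasing one of them with [flip]. *)
have diag m x : (#|[set k | x k]| <= m)%N -> 
    entry M x x = entry M [ffun=> false] [ffun=> false].
  elim: m x => [|m IH] x.
    rewrite leqn0 cards_eq0 => /eqP x0.
    rewrite (_ : x = [ffun=> false]) //; apply/ffunP=> q; rewrite ffunE.
    by have := in_set0 q; rewrite -x0 inE.
  have [k xk|x0] := pickP (fun k => x k); last first.
    move=> _; rewrite (_ : x = [ffun=> false]) //; apply/ffunP=> q.
    by rewrite ffunE x0.
  rewrite (cardsD1 k) inE xk /= add1n ltnS => le_m; rewrite -(flip k) IH //.
  apply: leq_trans le_m; apply: subset_leq_card.
  apply/subsetP=> q; rewrite !inE shift_pauli_at ffunE.
  by case: eqP => [->|_]; rewrite ?xk //= addbF.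
apply/entryP=> x y; rewrite entry_scalar.
by have [<-|/offdiag] := eqVneq x y; first by rewrite (diag _ _ (leqnn _)).
Qed.

End PauliOperators.

(** * Restoring the Paulis by staircases of boxes, with their timing *)

Section Synthesis.
Variable n : nat.
Implicit Types (g : gate n) (w : circuit n) (p a b : label n) (S : {set 'I_n}).
Implicit Types (i j k q : 'I_n) (D : 'I_n -> nat).
Local Open Scope nat_scope.

(* D q is the number of two-qubit layers after which qubit q becomes free. *)
Definition delay g D : 'I_n -> nat := fun q =>
  if g is GateCNOT c t _ then
    if q \in [set c; t] then (maxn (D c) (D t)).+1 else D q
  else D q.

Definition delays w D := foldl (fun D g => delay g D) D w.

Lemma delays_cat w w' D : delays (w ++ w') D = delays w' (delays w D).
Proof. exact: foldl_cat. Qed.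

Definition within S w := all (fun g => gate_support g \subset S) w.

Lemma within_cat S w w' : within S (w ++ w') = within S w && within S w'.
Proof. exact: all_cat. Qed.

Lemma sub_within S S' w : S \subset S' -> within S w -> within S' w.
Proof. by move=> sS; apply: sub_all => g /subset_trans->. Qed.

Lemma acts_id S w p : within S w -> (forall k, k \in S -> p k = pI) ->
  acts w p = p.
Proof.
elim: w p => //= g w IH p /andP[gS wS] p0.
by rewrite act_id ?IH // => k /(subsetP gS)/p0.
Qed.

Lemma acts_notin S w p k : within S w -> k \notin S -> acts w p k = p k.
Proof.
elim: w p => //= g w IH p /andP[gS wS] kS.
by rewrite IH // act_notin //; apply: contra kS => /(subsetP gS).
Qed.

Definition cnots w := count (@is_two_qubit n) w.

Lemma delays_within i j w D m : within [set i; j] w -> D i <= m -> D j <= m ->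
  forall q, delays w D q <= if q \in [set i; j] then m + cnots w else D q.
Proof.
rewrite /cnots; elim: w D m => [|g w IH] D m /=.
  move=> _ Di Dj q; rewrite addn0; case: ifP => // /set2P[] -> //.
case/andP=> gS wS Di Dj q.
have bound r : delay g D r <= if r \in [set i; j] then m + is_two_qubit g else D r.
  case: g gS => [s|s|c t ct] /= gS.
  - by rewrite addn0; case: ifP => // /set2P[] ->.
  - by rewrite addn0; case: ifP => // /set2P[] ->.
  have Dm s : s \in [set c; t] -> D s <= m.
    by move/(subsetP gS) => /set2P[] ->.
  case: ifPn => [rct|_].
    by rewrite (subsetP gS) // addn1 ltnS geq_max !Dm ?inE ?eqxx ?orbT.
  by case: ifPn => // /set2P[] ->; rewrite (leq_trans _ (leq_addr _ _)).
have := IH (delay g D) (m + is_two_qubit g) wS; rewrite !addnA => IHq.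
apply: leq_trans (IHq _ _ q) _.
- by apply: leq_trans (bound i) _; rewrite !inE eqxx.
- by apply: leq_trans (bound j) _; rewrite !inE eqxx orbT.
- by have := bound q; case: (q \in [set i; j]).
Qed.

Lemma delays_single w D : all (fun g => ~~ is_two_qubit g) w -> delays w D = D.
Proof. by elim: w D => //= -[q|q|c t ct] w IH D //= /IH. Qed.

Definition to_X (v : bool * bool) q : circuit n :=
  match v with
  | (true, true) => [:: GateP q]
  | (false, true) => [:: GateH q]
  | _ => [::]
  end.

Lemma to_XP p q : p q != pI -> acts (to_X (p q) q) p q = pX.
Proof. by case E: (p q) => [[] []] //= _; rewrite ffunE eqxx E. Qed.

Lemma within_to_X v q : within [set q] (to_X v q).
Proof. by case: v => [[] []] /=; rewrite ?subxx. Qed.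

Lemma single_to_X v q : all (fun g => ~~ is_two_qubit g) (to_X v q).
Proof. by case: v => [[] []]. Qed.

Lemma single_lnn w : all (fun g => ~~ is_two_qubit g) w -> lnn w.
Proof. by apply: sub_all => -[]. Qed.

Lemma single_cnots w : all (fun g => ~~ is_two_qubit g) w -> cnots w = 0.
Proof. by rewrite /cnots; elim: w => //= g w IH /andP[/negPf-> /IH->]. Qed.

Lemma lnn_cat w w' : lnn (w ++ w') = lnn w && lnn w'.
Proof. exact: all_cat. Qed.

(** Single-qubit gates turn a nontrivial label at i into X, and the one at j into I or X. If it is
    I, a CNOT from i to j first copies the X; then the CNOT from j to i cancels the X at i. *)
Lemma box_clear i j a : j = i.+1 :> nat ->
  exists w, [/\ lnn w, within [set i; j] w, cnots w <= 2 & acts w a i = pI].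
Proof.
move=> ji; have ij : i != j by rewrite -val_eqE /= ji; lia.
have ji' : j != i by rewrite eq_sym.
have [ai0|ai] := eqVneq (a i) pI; first by exists [::].
set w1 := to_X (a i) i ++ to_X (a j) j.
have w1X : acts w1 a i = pX.
  by rewrite acts_cat (acts_notin _ (within_to_X _ _)) ?inE // to_XP.
have w1j : acts w1 a j = if a j == pI then pI else pX.
  have aj : acts (to_X (a i) i) a j = a j.
    by rewrite (acts_notin _ (within_to_X _ _)) ?inE.
  rewrite acts_cat -aj; set p := acts _ a.
  by have [pj|/to_XP//] := eqVneq (p j) pI; rewrite pj.
have w1S : within [set i; j] w1.
  by rewrite within_cat !(sub_within _ (within_to_X _ _)) // sub1set !inE eqxx ?orbT.
have w1s : all (fun g => ~~ is_two_qubit g) w1 by rewrite all_cat !single_to_X.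
clearbody w1; exists (w1 ++ (if a j == pI then [:: GateCNOT ij] else [::]) ++ [:: GateCNOT ji']).
split.
- rewrite !lnn_cat (single_lnn w1s) /=.
  by case: ifP; rewrite /= ji eqxx ?orbT.
- rewrite !within_cat w1S /= [[set j; i]]setUC subxx andbT.
  by case: ifP; rewrite //= subxx.
- rewrite /cnots !count_cat -/(cnots w1) (single_cnots w1s).
  by case: ifP.
- rewrite !acts_cat; case: eqP w1j => _ w1j /=;
    by rewrite !ffunE !eqxx ?(negPf ij) ?(negPf ji') w1X w1j.
Qed.

(** HPH adds the Z bit to the X bit, so it fixes X and turns XZ into Z. *)
Lemma fix_partner k b : (b k).2 -> exists w,
  [/\ within [set k] w, all (fun g => ~~ is_two_qubit g) w,
      acts w (pauli_at k pX) = pauli_at k pX & acts w b k = pZ].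
Proof.
move=> bk.
exists (if (b k).1 then [:: GateH k; GateP k; GateH k] else [::]); split.
- by case: ifP; rewrite //= !subxx.
- by case: ifP.
- apply/ffunP=> q; rewrite !ffunE; case: ifP; rewrite /= !ffunE //.
  by case: eqVneq.
- move: bk; case E: (b k) => [[] []] //= _.
  by rewrite !ffunE !eqxx E.
Qed.

(** With Z on both qubits, the CNOT from i to k cancels the Z at i. Since k is its target, X_k is
    preserved. *)
Lemma box_finish i k b : k = i.+1 :> nat -> (b k).2 ->
  exists w, [/\ lnn w, within [set i; k] w, cnots w <= 2,
    acts w (pauli_at k pX) = pauli_at k pX & acts w b i = pI /\ acts w b k = pZ].
Proof.
move=> ki bk; have ik : i != k by rewrite -val_eqE /= ki; lia.
have ki' : k != i by rewrite eq_sym.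
have Xi : pauli_at k pX i = pI by rewrite ffunE (negPf ik).
have [w1 [w1S w1s w1X w1b]] := fix_partner bk.
have w1i : acts w1 b i = b i by rewrite (acts_notin _ w1S) ?inE.
have [bi0|bi] := eqVneq (b i) pI.
  exists w1; rewrite single_lnn // single_cnots //; split=> //.
    by apply: sub_within w1S; rewrite sub1set !inE eqxx orbT.
  by rewrite w1i.
set w2 := to_X (b i) i ++ [:: GateH i].
have w2S : within [set i] w2 by rewrite within_cat within_to_X /= subxx.
have w2s : all (fun g => ~~ is_two_qubit g) w2 by rewrite all_cat single_to_X.
have w2i : acts w2 (acts w1 b) i = pZ.
  by rewrite acts_cat -w1i /= ffunE eqxx to_XP ?w1i.
have w2k : acts w2 (acts w1 b) k = pZ by rewrite (acts_notin _ w2S) ?inE.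
have w2X : acts w2 (pauli_at k pX) = pauli_at k pX.
  by apply: acts_id w2S _ => q /set1P->.
clearbody w2; exists (w1 ++ w2 ++ [:: GateCNOT ik]); split.
- by rewrite !lnn_cat (single_lnn w1s) (single_lnn w2s) /= ki eqxx.
- rewrite !within_cat /= subxx (sub_within _ w1S) ?(sub_within _ w2S) //.
    by rewrite sub1set !inE eqxx.
  by rewrite sub1set !inE eqxx orbT.
- by rewrite /cnots !count_cat -/(cnots w1) -/(cnots w2) (single_cnots w1s) (single_cnots w2s).
- rewrite !acts_cat w1X w2X /=; apply/ffunP=> q; rewrite !ffunE eqxx (negPf ik) /=.
  by case: (eqVneq q k) => // _; case: eqP.
- by rewrite !acts_cat /= !ffunE !eqxx (negPf ik) w2i w2k.
Qed.

(* The left end of a staircase of boxes has already advanced to qubit m, *)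
(* and the slope 2 leaves room for the next staircase to follow.         *)
Definition staircase (B m q : nat) : nat :=
  if q < m then B + 4 + 2 * q else if q == m then B + 2 + 2 * m else B + 2 * q.

Definition below (m : nat) : {set 'I_n} := [set q : 'I_n | q <= m].

(** Both qubits are free by time B + 2 + 2i and the box takes at most two layers. The end time B + 4
    + 2i is the final bound for i and equals B + 2 + 2j, the value from which the next box
    starts. *)
Lemma staircase_box i j w B D : j = i.+1 :> nat -> within [set i; j] w ->
  cnots w <= 2 -> (forall q, D q <= staircase B i q) ->
  forall q, delays w D q <= staircase B j q.
Proof.
move=> ji wS w2 DB q; have := @delays_within i j w D (B + 2 + 2 * i) wS.
have Di := DB i; have Dj := DB j; have Dq := DB q.
rewrite /staircase ltnn eqxx in Di; rewrite /staircase ji in Dj.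
rewrite ltnNge leqnSn eqn_leq ltnn /= in Dj.
move=> /(_ Di) /(_ ltac:(lia)) /(_ q); move: Dq.
rewrite /staircase !inE -!(inj_eq val_inj) /= ji ltnS.
by case: (ltngtP q i) => [||->]; case: (ltngtP q i.+1) => //=; lia.
Qed.

Lemma sweep (m : nat) a : m < n -> exists w,
  [/\ lnn w, within (below m) w, forall q, q < m -> acts w a q = pI &
      forall D B, (forall q, D q <= B + 2 * q) ->
        forall q, delays w D q <= staircase B m q].
Proof.
elim: m => [|m IH] mn.
  exists [::]; split=> // D B DB q; apply: leq_trans (DB q) _; rewrite /staircase /=.
  by case: eqP => [->|]; lia.
have [w [wl wS w0 wD]] := IH (ltnW mn).
pose i := Ordinal (ltnW mn); pose j := Ordinal mn.
have [v [vl vS v2 vi]] := @box_clear i j (acts w a) erefl.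
exists (w ++ v); split.
- by rewrite lnn_cat wl.
- rewrite within_cat (sub_within _ wS) ?(sub_within _ vS) //.
    by apply/subsetP=> q /set2P[] ->; rewrite inE //= leqnSn.
  by apply/subsetP=> q; rewrite !inE => /leqW.
- move=> q; rewrite ltnS leq_eqVlt acts_cat => /predU1P[qm|qm].
    by rewrite (_ : q = i) //; apply: val_inj.
  rewrite (acts_notin _ vS) ?w0 // !inE -!val_eqE /=; lia.
- move=> D B DB q; rewrite delays_cat.
  by apply: (@staircase_box i j) => // r; apply: wD.
Qed.

Lemma staircaseW B m q : q <= m -> staircase B m q <= B + 4 + 2 * q.
Proof. by rewrite /staircase => qm; case: ltngtP qm => [||->]; lia. Qed.

(** The sweep stops at qubit k - 1, so it cannot touch X_k; only the last box, on (k - 1, k), must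
    respect X_k, which [box_finish] ensures. *)
Lemma finish k b : (b k).2 -> exists w,
  [/\ lnn w, within (below k) w, acts w (pauli_at k pX) = pauli_at k pX,
      (forall q, q < k -> acts w b q = pI) /\ acts w b k = pZ &
      forall D B, (forall q, D q <= B + 2 * q) ->
        forall q, delays w D q <= B + 4 + 2 * q].
Proof.
move=> bk; case: k bk => -[|m] mn; set k := Ordinal mn => bk.
  have [v [vS vs vX vk]] := fix_partner bk.
  exists v; split=> // [||D B DB q]; first exact: single_lnn.
    by apply: sub_within vS; rewrite sub1set inE.
  by rewrite delays_single //; have := DB q; lia.
have [w [wl wS w0 wD]] := @sweep m b (ltnW mn).
have kb : k \notin below m by rewrite inE /= -ltnNge.
have bk' : (acts w b k).2 by rewrite (acts_notin _ wS).
have [v [vl vS v2 vX [vi vk]]] := @box_finish (Ordinal (ltnW mn)) k _ erefl bk'.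
have wX : acts w (pauli_at k pX) = pauli_at k pX.
  apply: acts_id wS _ => q; rewrite ffunE; case: eqP => // ->.
  by rewrite (negPf kb).
exists (w ++ v); split.
- by rewrite lnn_cat wl.
- rewrite within_cat (sub_within _ wS) ?(sub_within _ vS) //.
    by apply/subsetP=> q /set2P[] ->; rewrite inE //= leqnSn.
  by apply/subsetP=> q; rewrite !inE => /leqW.
- by rewrite acts_cat wX.
- rewrite acts_cat; split=> // q; rewrite ltnS leq_eqVlt => /predU1P[qm|qm].
    by rewrite -[RHS]vi; congr (acts _ _ _); apply: val_inj.
  rewrite (acts_notin _ vS) ?w0 // !inE -!val_eqE /=; lia.
- move=> D B DB q; rewrite delays_cat.
  have := @staircase_box (Ordinal (ltnW mn)) k v B (delays w D) erefl vS v2 (wD D B DB) q.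
  have [qk /leq_trans|kq] := leqP q k; first by apply; apply: staircaseW.
  by rewrite /staircase; case: ltngtP kq => //; lia.
Qed.

Definition fixes w k := acts w (pauli_at k pX) = pauli_at k pX /\
  acts w (pauli_at k pZ) = pauli_at k pZ.

(** The two bits of a label at k are its symplectic products with X_k and Z_k, and the form is
    preserved. *)
Lemma fixes_coord w k p : fixes w k -> acts w p k = p k.
Proof.
case=> wX wZ; have := symp_acts w (pauli_at k pX) p.
have := symp_acts w (pauli_at k pZ) p.
rewrite wX wZ !symp_pauli_at /= !addbF.
by case: (acts w p k) (p k) => [x z] [x' z'] /= -> ->.
Qed.

Lemma fix_qubit c k : (forall j, k < j -> fixes c j) -> exists w,
  [/\ lnn w, forall j, k <= j -> fixes (c ++ w) j &
      forall D B, (forall q, D q <= B + 2 * q) ->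
        forall q, delays w D q <= B + 8 + 2 * q].
Proof.
move=> cj.
have above p j : k < j -> p j = pI -> acts c p j = pI.
  by move/cj=> cfix <-; apply: fixes_coord.
have [w1 [w1l w1S w1a w1D]] := sweep (acts c (pauli_at k pX)) (ltn_ord k).
set a1 := acts w1 _ in w1a.
have a1_eq : a1 = pauli_at k (a1 k).
  apply/ffunP=> q; rewrite [RHS]ffunE; case: eqP => [->//|/eqP qk].
  have [/w1a//|kq|/val_inj qk'] := ltngtP q k; last by rewrite qk' eqxx in qk.
  rewrite /a1 (acts_notin _ w1S) ?inE -?ltnNge // above //.
  by rewrite ffunE (negPf qk).
(* The image of X_k still anticommutes with that of Z_k, so it is not trivial. *)
have a1k : a1 k != pI.
  have := symp_acts (c ++ w1) (pauli_at k pX) (pauli_at k pZ).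
  rewrite !acts_cat -/a1 symp_pauli_at ffunE eqxx /= => sa1.
  apply: contraTneq sa1 => a10.
  by rewrite a1_eq a10 symp_pauli_at.
set t := to_X (a1 k) k; have tS : within [set k] t by apply: within_to_X.
have a1X : acts t a1 = pauli_at k pX.
  apply/ffunP=> q; rewrite ffunE; case: eqP => [->|/eqP qk].
    exact: to_XP.
  by rewrite (acts_notin _ tS) ?inE // a1_eq ffunE (negPf qk).
set b := acts (c ++ w1 ++ t) (pauli_at k pZ).
(* X_k is now in place, and the image of Z_k anticommutes with it. *)
have bk : (b k).2.
  have := symp_acts (c ++ w1 ++ t) (pauli_at k pX) (pauli_at k pZ).
  rewrite -/b !acts_cat -/a1 a1X !symp_pauli_at ffunE eqxx /=.
  by rewrite !addbF.
have [w2 [w2l w2S w2X [w2b w2k] w2D]] := finish bk.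
have kS : [set k] \subset below k by rewrite sub1set inE.
exists (w1 ++ t ++ w2); split.
- by rewrite !lnn_cat w1l w2l single_lnn // single_to_X.
- have wS : within (below k) (w1 ++ t ++ w2).
    by rewrite !within_cat w1S w2S (sub_within kS tS).
  move=> j; rewrite leq_eqVlt => /predU1P[/val_inj <-|kj].
    split; first by rewrite !acts_cat -/a1 a1X.
    have -> : acts (c ++ w1 ++ t ++ w2) (pauli_at k pZ) = acts w2 b.
      by rewrite /b -acts_cat !catA.
    apply/ffunP=> q; rewrite ffunE; case: eqP => [->//|/eqP qk].
    have [/w2b//|kq|/val_inj qk'] := ltngtP q k; last by rewrite qk' eqxx in qk.
    rewrite (acts_notin _ w2S) ?inE -?ltnNge // /b acts_cat.
    rewrite (@acts_notin (below k)) ?inE -?ltnNge //; last first.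
      by rewrite within_cat w1S (sub_within kS tS).
    by rewrite above // ffunE (negPf qk).
  have [cX cZ] := cj j kj.
  have zero v q : q \in below k -> pauli_at j v q = pI.
    by rewrite inE ffunE => qk; case: eqP => // qj; rewrite -qj ltnNge qk in kj.
  by split; rewrite acts_cat ?cX ?cZ; apply: acts_id wS (zero _).
- move=> D B DB q; rewrite !delays_cat (delays_single _ (single_to_X _ _)).
  apply: leq_trans (w2D _ (B + 4) _ q) _; last by lia.
  move=> {}q; have := w1D D B DB q.
  have [qk /leq_trans|kq] := leqP q k; first by apply; apply: staircaseW.
  by rewrite /staircase; case: ltngtP kq => //; lia.
Qed.

Lemma fix_qubits c : exists w, [/\ lnn w, forall k, fixes (c ++ w) k &
  forall q, delays w (fun=> 0) q <= 10 * n - 2].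
Proof.
(* Each of the m restored qubits costs two staircases of four layers; the slope 2q is paid only
   once. *)
suff IH m : m <= n -> exists w, [/\ lnn w,
    forall k, n - m <= k -> fixes (c ++ w) k &
    forall q, delays w (fun=> 0) q <= 8 * m + 2 * q].
  have [w [wl wf wD]] := IH n (leqnn n); exists w; split=> // [k|q].
    by apply: wf; rewrite subnn.
  by apply: leq_trans (wD q) _; have := ltn_ord q; lia.
elim: m => [_|m IH mn].
  by exists [::]; split=> // k; rewrite subn0 leqNgt ltn_ord.
have [w [wl wf wD]] := IH (ltnW mn).
have km : n - m.+1 < n by lia.
have [j|v [vl vf vD]] := @fix_qubit (c ++ w) (Ordinal km).
  by move=> /= kj; apply: wf; lia.
exists (w ++ v); split.
- by rewrite lnn_cat wl.
- by move=> k nk; rewrite catA; apply: vf => /=; lia.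
- by move=> q; rewrite delays_cat; apply: leq_trans (vD _ _ wD q) _; lia.
Qed.

End Synthesis.

(** * Turning delays into an actual layering *)

Section Scheduling.
Variables (C : numClosedFieldType) (n : nat).
Implicit Types (g h : gate n) (c w : circuit n) (q r : 'I_n).
Implicit Types (B L S : nat -> circuit n).

Lemma circuit_mx_rcons c g : circuit_mx C (rcons c g) = gate_mx C g *m circuit_mx C c.
Proof. by rewrite -cats1 circuit_mx_cat /= mul1mx. Qed.

Definition untouched q c := all (fun g => q \notin gate_support g) c.

Lemma untouched_disjoint g c : (forall q, q \in gate_support g -> untouched q c) ->
  all (fun h => [disjoint gate_support g & gate_support h]) c.
Proof.
elim: c => //= h c IH gc; rewrite IH => [|q /gc /andP[]//]; rewrite andbT.
by rewrite disjoint_subset; apply/subsetP=> q /gc /andP[].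
Qed.

Lemma circuit_gate_comm g c :
    all (fun h => [disjoint gate_support g & gate_support h]) c ->
  gate_mx C g *m circuit_mx C c = circuit_mx C c *m gate_mx C g.
Proof.
elim: c => [|h c IH] /=; first by rewrite mulmx1 mul1mx.
by case/andP=> gh /IH gc; rewrite mulmxA gc -!mulmxA gate_comm.
Qed.

Fixpoint concat_blocks B T : circuit n :=
  if T is T'.+1 then concat_blocks B T' ++ B T' else [::].

(** A gate commuting with all later blocks may be put at the end of block t instead of at the end of
    the circuit. *)
Lemma concat_blocks_insert B B' g t T :
    (forall t', t' != t -> B' t' = B t') ->
    circuit_mx C (B' t) = gate_mx C g *m circuit_mx C (B t) ->
    (forall t', (t < t')%N ->
       all (fun h => [disjoint gate_support g & gate_support h]) (B t')) ->
  circuit_mx C (concat_blocks B' T) =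
  if (t < T)%N then gate_mx C g *m circuit_mx C (concat_blocks B T)
  else circuit_mx C (concat_blocks B T).
Proof.
move=> BB' Bt later; elim: T => //= T IH.
rewrite !circuit_mx_cat IH ltnS; case: (ltngtP t T) => [tT|Tt|tT].
- by rewrite BB' ?gtn_eqF // mulmxA -circuit_gate_comm ?later // mulmxA.
- by rewrite BB' ?ltn_eqF.
- by rewrite -tT Bt mulmxA.
Qed.

Lemma layered_cat c c' d d' :
  layered c d -> layered c' d' -> layered (c ++ c') (d + d').
Proof.
move=> lc lc'; elim: lc => //= [g {}c {}d gs _|L {}c {}d L2 _] IH.
  exact: LayeredSingle.
by rewrite -catA addSn; apply: LayeredTwo.
Qed.

Lemma layered_block (L S : circuit n) : two_qubit_layer L ->
  all (fun g => ~~ is_two_qubit g) S -> layered (L ++ S) 1.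
Proof.
move=> L2 Ss; apply: LayeredTwo => //; elim: S Ss => [|g S IH] /=.
  by constructor.
by case/andP=> gs /IH; apply: LayeredSingle.
Qed.

Lemma delay_ge g D q : (D q <= delay g D q)%N.
Proof.
case: g => // c t ct /=; case: ifPn => // /set2P[] ->.
  by rewrite leqW ?leq_maxl.
by rewrite leqW ?leq_maxr.
Qed.

(** Greedy scheduling: each gate goes into the block numbered by the delay of its qubits after it.
    The invariant that no block beyond the delay of q touches q keeps layers disjoint and lets the
    new gate commute past later blocks. *)
Lemma schedule_blocks w : lnn w -> exists L, exists S,
  [/\ forall t, two_qubit_layer (L t) /\ lnn (L t),
      forall t, all (fun g => ~~ is_two_qubit g) (S t),
      forall t q, (delays w (fun=> 0) q < t)%N -> untouched q (L t ++ S t) &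
      forall T, (forall q, (delays w (fun=> 0) q < T)%N) ->
        circuit_mx C (concat_blocks (fun t => L t ++ S t) T) = circuit_mx C w].
Proof.
elim/last_ind: w => [_|w g IH].
  by exists (fun=> [::]), (fun=> [::]); split=> // T _; elim: T => //= T; rewrite cats0.
rewrite /lnn all_rcons => /andP[gl /IH[L [S [LP SP free mxE]]]] {IH}.
rewrite /delays -cats1 foldl_cat /= -/(delays w _).
set D := delays w _ in free mxE *; rewrite cats1.
have gD T : (forall q, (delay g D q < T)%N) -> forall q, (D q < T)%N.
  by move=> DT q; apply: leq_ltn_trans (DT q); apply: delay_ge.
have [g2|g1] := boolP (is_two_qubit g).
- have [t tD gt] : exists2 t, (forall q, q \in gate_support g -> (D q < t)%N) &
      (forall q, q \in gate_support g -> delay g D q = t).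
    case: g g2 {gl gD} => // c t ct _; exists (maxn (D c) (D t)).+1 => q /=.
      by case/set2P=> ->; rewrite ltnS ?leq_maxl ?leq_maxr.
    by move->.
  exists (fun t' => if t' == t then rcons (L t') g else L t'), S.
  have later t' : (t <= t')%N ->
      all (fun h => [disjoint gate_support g & gate_support h]) (L t' ++ S t').
    move=> tt'; apply: untouched_disjoint => q /tD qt.
    by apply: free; apply: leq_trans tt'.
  split=> // [t'|t' q qt'|T DT].
  + case: eqP => [->|_]; last exact: LP.
    have [/andP[Lt2 Ltd] Ltl] := LP t; rewrite /lnn all_rcons gl; split=> //.
    rewrite /two_qubit_layer all_rcons g2 Lt2 pairwise_rcons Ltd /= andbT.
    have := later _ (leqnn t); rewrite all_cat => /andP[+ _].
    by apply: sub_all => h; rewrite disjoint_sym.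
  + have := free t' q (leq_ltn_trans (delay_ge g D q) qt').
    case: eqP qt' => [->|//] qt; rewrite /untouched !all_cat all_rcons => /andP[-> ->].
    rewrite !andbT; by apply: contraTN qt => /gt ->; rewrite ltnn.
  + rewrite (@concat_blocks_insert (fun t => L t ++ S t) _ g t).
    * rewrite (mxE _ (gD _ DT)) circuit_mx_rcons ifT //.
      case: g g2 gt {gl gD later tD} DT => // c t' ct _ /= gt DT.
      by rewrite -(gt c) ?DT // !inE eqxx.
    * by move=> t' /negPf->.
    * rewrite eqxx !circuit_mx_cat circuit_mx_rcons mulmxA.
      have := later _ (leqnn t); rewrite all_cat => /andP[_ /circuit_gate_comm <-].
      by rewrite mulmxA.
    * by move=> t' /ltnW; apply: later.
- have [q0 gq0] : exists q, gate_support g = [set q].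
    by case: g g1 {gl gD} => [q|q|//] _; exists q.
  have gDE : delay g D = D by case: g g1 {gl gD gq0}.
  rewrite gDE.
  exists L, (fun t' => if t' == D q0 then rcons (S t') g else S t').
  split=> // [t'|t' q qt'|T DT].
  + by case: eqP => [->|//]; rewrite all_rcons g1 SP.
  + have := free t' q qt'; case: eqP qt' => [->|//] qt.
    rewrite /untouched !all_cat all_rcons gq0 => /andP[-> ->].
    by rewrite inE !andbT; apply: contraTneq qt => ->; rewrite ltnn.
  + rewrite (@concat_blocks_insert (fun t => L t ++ S t) _ g (D q0)) ?DT.
    * by rewrite mxE // circuit_mx_rcons.
    * by move=> t' /negPf->.
    * by rewrite eqxx !circuit_mx_cat circuit_mx_rcons mulmxA.
    * move=> t' tt'; apply: untouched_disjoint => q; rewrite gq0 => /set1P->.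
      exact: free.
Qed.

(** Blocks are numbered from 0, so T must strictly exceed every delay. *)
Lemma schedule w T : lnn w -> (forall q, (delays w (fun=> 0) q < T)%N) ->
  exists c, [/\ circuit_mx C c = circuit_mx C w, lnn c & layered c T].
Proof.
move=> /schedule_blocks[L [S [LP SP _ mxE]]] DT.
exists (concat_blocks (fun t => L t ++ S t) T); split; first exact: mxE.
  elim: T {DT} => //= T IH; rewrite !lnn_cat IH (single_lnn (SP T)).
  by have [_ ->] := LP T.
elim: T {DT} => [|T IH] /=; first by constructor.
rewrite -addn1; apply: layered_cat => //; apply: layered_block => //.
by have [] := LP T.
Qed.

End Scheduling.

(** * Arithmetic of Z[i, 1/sqrt 2] and the global scalar *)

Section GlobalPhase.
Variable C : numClosedFieldType.
Local Notation sqrt2 := (sqrtC 2 : C).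

Definition zi2 (a b c d : int) : C :=
  a%:~R + b%:~R * 'i + sqrt2 * (c%:~R + d%:~R * 'i).

(* Z[i, 1 / sqrt 2] *)
Definition dyadic (z : C) := exists m a b c d, z * sqrt2 ^+ m = zi2 a b c d.

Let sqrt2K : sqrt2 ^+ 2 = 2.
Proof. exact: sqrtCK. Qed.

Let iK : 'i ^+ 2 = -1 :> C.
Proof. exact: sqrCi. Qed.

Lemma zi2M a b c d a' b' c' d' : exists a'' b'' c'' d'',
  zi2 a b c d * zi2 a' b' c' d' = zi2 a'' b'' c'' d''.
Proof.
exists (a * a' - b * b' + 2 * (c * c' - d * d')), (a * b' + b * a' + 2 * (c * d' + d * c')),
  (a * c' - b * d' + c * a' - d * b'), (a * d' + b * c' + c * b' + d * a').
rewrite /zi2 !(rmorphD, rmorphB, rmorphM) /=; ring: sqrt2K iK.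
Qed.

Lemma zi2D a b c d a' b' c' d' :
  zi2 a b c d + zi2 a' b' c' d' = zi2 (a + a') (b + b') (c + c') (d + d').
Proof. by rewrite /zi2 !rmorphD /=; ring. Qed.

Lemma zi2_sqrt2 m : exists a b c d, sqrt2 ^+ m = zi2 a b c d.
Proof.
elim: m => [|m [a [b [c [d IH]]]]].
  by exists 1, 0, 0, 0; rewrite expr0 /zi2 /=; ring.
have -> : sqrt2 ^+ m.+1 = zi2 0 0 1 0 * zi2 a b c d by rewrite -IH exprS /zi2; ring.
exact: zi2M.
Qed.

Lemma dyadicM z z' : dyadic z -> dyadic z' -> dyadic (z * z').
Proof.
move=> [m [a [b [c [d E]]]]] [m' [a' [b' [c' [d' E']]]]]; exists (m + m')%N.
by rewrite exprD mulrACA E E'; apply: zi2M.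
Qed.

Lemma dyadicD z z' : dyadic z -> dyadic z' -> dyadic (z + z').
Proof.
move=> [m [a [b [c [d E]]]]] [m' [a' [b' [c' [d' E']]]]]; exists (m + m')%N.
have [x [y [u [v ->]]]] : exists x y u v, (z + z') * sqrt2 ^+ (m + m') =
    zi2 x y u v; last by exists x, y, u, v.
rewrite exprD mulrDl mulrA E [_ ^+ m * _]mulrC mulrA E'.
have [x [y [u [v ->]]]] := zi2_sqrt2 m; have [x' [y' [u' [v' ->]]]] := zi2_sqrt2 m'.
have [? [? [? [? ->]]]] := zi2M a b c d x' y' u' v'.
have [? [? [? [? ->]]]] := zi2M a' b' c' d' x y u v.
by rewrite zi2D; do 4!eexists.
Qed.

Lemma dyadic_zi2 a b c d : dyadic (zi2 a b c d).
Proof. by exists 0%N, a, b, c, d; rewrite mulr1. Qed.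

Lemma dyadic0 : dyadic 0.
Proof. by rewrite (_ : 0 = zi2 0 0 0 0); [apply: dyadic_zi2 | rewrite /zi2; ring]. Qed.

Lemma dyadic1 : dyadic 1.
Proof. by rewrite (_ : 1 = zi2 1 0 0 0); [apply: dyadic_zi2 | rewrite /zi2; ring]. Qed.

Lemma dyadicN1 : dyadic (-1).
Proof. by rewrite (_ : -1 = zi2 (-1) 0 0 0); [apply: dyadic_zi2 | rewrite /zi2 rmorphN; ring]. Qed.

Lemma dyadicCi : dyadic 'i.
Proof. by rewrite (_ : 'i = zi2 0 1 0 0); [apply: dyadic_zi2 | rewrite /zi2; ring]. Qed.

Lemma dyadic_sqrt2V : dyadic sqrt2^-1.
Proof. by exists 1%N, 1, 0, 0, 0; rewrite expr1 mulVf ?sqrt2_neq0 // /zi2; ring. Qed.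

Lemma dyadic_circuit n (c : circuit n) i j : dyadic (circuit_mx C c i j).
Proof.
elim: c i j => [|g c IH] i j /=.
  by rewrite mxE; case: (_ == _); [apply: dyadic1 | apply: dyadic0].
rewrite mxE; apply: big_ind => [||k _]; [exact: dyadic0 | exact: dyadicD |].
apply: dyadicM => //; case: g => [q|q|x y xy] /=; rewrite mxE /=.
- case: ifP => _; last exact: dyadic0; rewrite /hadamard.
  apply: dyadicM; last exact: dyadic_sqrt2V.
  by case: (_ && _); [apply: dyadicN1 | apply: dyadic1].
- case: ifP => _; last exact: dyadic0; rewrite /phase; case: eqP => _; last exact: dyadic0.
  by case: (enum_val k q); [apply: dyadicCi | apply: dyadic1].
- by case: (_ == _); [apply: dyadic1 | apply: dyadic0].
Qed.

Definition omega : C := (1 + 'i) / sqrt2.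

Lemma omegaE : omega = sqrt2 * (1 + 'i) / 2.
Proof. by rewrite /omega sqrt2V; ring. Qed.

Lemma omega_sqr : omega ^+ 2 = 'i.
Proof. by rewrite omegaE; field: sqrt2K iK. Qed.

Lemma omega8 : omega ^+ 8 = 1.
Proof. by rewrite (exprM _ 2 4) omega_sqr (exprM _ 2 2) iK sqrrN expr1n. Qed.

(** In x^2 = 2 y^2 with y nonzero, the 2-adic valuation is even on the left and odd on the right. *)
Lemma sqrt2_irrational (x y : int) : x%:~R + sqrt2 * y%:~R = 0 -> x = 0 /\ y = 0.
Proof.
move=> xy0; have xE : x%:~R = - (sqrt2 * y%:~R) by apply/eqP; rewrite -addr_eq0 xy0.
have {xE} : (`|x| ^ 2 = 2 * `|y| ^ 2)%N.
  apply/eqP; rewrite -(eqr_nat int) natrM !natrX !natz !abszE !real_normK ?num_real //.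
  rewrite -(eqr_int C) rmorphXn rmorphM rmorphXn /= xE sqrrN exprMn sqrt2K; exact/eqP.
have [y0|y0] := posnP `|y|%N.
  move/eqP: y0; rewrite absz_eq0 => /eqP->; rewrite absz0 muln0 => /eqP.
  by rewrite expn_eq0 absz_eq0 andbT => /eqP->.
move/(congr1 (logn 2)); rewrite lognM ?expn_gt0 ?y0 // !lognX => /(congr1 odd).
by rewrite oddD !oddM.
Qed.

(** The hypotheses are the two components of |z|^2 = 2^m in the basis 1, sqrt 2. The proof descends
    on m by dividing z by sqrt 2. *)
Lemma omega_powers m (a b c d : int) :
    a * a + b * b + 2 * (c * c) + 2 * (d * d) = 2 ^+ m -> a * c + b * d = 0 ->
  exists k, zi2 a b c d = sqrt2 ^+ m * omega ^+ k.
Proof.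
have omega1 : sqrt2 * omega = 1 + 'i by rewrite mulrC divfK ?sqrt2_neq0.
have small (x : int) : x * x <= 1 -> [\/ x = 0, x = 1 | x = -1].
  have [x0|[x1|[x2|xx]]] : x = 0 \/ x = 1 \/ x = -1 \/ 2 <= x * x by nia.
  - by constructor 1.
  - by constructor 2.
  - by constructor 3.
  - lia.
have omega4 : omega ^+ 4 = -1 by rewrite (exprM _ 2 2) omega_sqr iK.
elim: m a b c d => [|m IH] a b c d.
  rewrite expr0 => nE _.
  have c0 : c = 0 by nia.
  have d0 : d = 0 by nia.
  subst c d.
  have := small a ltac:(nia); have := small b ltac:(nia).
  case=> bE; case=> aE; subst a b; try lia.
  - by exists 0%N; rewrite /zi2 expr0; ring.
  - by exists 4%N; rewrite omega4 /zi2 rmorphN; ring.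
  - by exists 2%N; rewrite omega_sqr /zi2; ring.
  - by exists 6%N; rewrite (exprD _ 4 2) omega4 omega_sqr /zi2 rmorphN; ring.
rewrite exprS => nE acbd.
have [a' [ea aE]] : exists a', exists e : bool, a = 2 * a' + (e : nat)%:Z.
  by exists (a %/ 2)%Z, (a %% 2 != 0)%Z; lia.
have [b' [eb bE]] : exists b', exists e : bool, b = 2 * b' + (e : nat)%:Z.
  by exists (b %/ 2)%Z, (b %% 2 != 0)%Z; lia.
(* Parities of a and b must agree because the norm is even. If both are even, z / sqrt 2 has
   coefficients c, d, a / 2, b / 2. *)
case: ea eb aE bE => [] [] /= aE bE; try (subst a b; lia); last first.
  subst a b; have [||k kE] := IH c d a' b'; [lia|lia|exists k].
  rewrite exprS -mulrA -kE /zi2 !addr0 !rmorphM /=; ring: sqrt2K.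
(* For odd a, b, the relation ac + bd = 0 forces c and d to have the same parity. The norm is then 2
   modulo 4, which leaves only the exponent 1. *)
case: m {IH} nE => [|m]; last first.
  have [e dE] : exists e, d = - c - 2 * e.
    by exists (a' * c + b' * d); subst a b; lia.
  by rewrite exprS => nE; subst a b d; lia.
rewrite expr0 mulr1 => nE.
have c0 : c = 0 by nia.
have d0 : d = 0 by nia.
have := small a ltac:(nia); have := small b ltac:(nia); rewrite expr1.
subst c d; case=> bE'; case=> aE'; try lia; rewrite {}aE' {}bE'.
- by exists 1%N; rewrite expr1 omega1 /zi2; ring.
- by exists 3%N; rewrite exprS mulrA omega1 omega_sqr /zi2 rmorphN /=; ring: iK.
- exists 7%N; rewrite exprS mulrA omega1 (exprD _ 4 2) omega4 omega_sqr /zi2 rmorphN /=.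
  by ring: iK.
- by exists 5%N; rewrite exprS mulrA omega1 omega4 /zi2 !rmorphN /=; ring.
Qed.

Lemma dyadic_norm1 z : dyadic z -> `|z| = 1 -> exists k, z = omega ^+ k.
Proof.
move=> [m [a [b [c [d E]]]]] z1; have sqrt2R : sqrt2 \is Num.real.
  by rewrite ger0_real // sqrtC_ge0 ler0n.
have conjE : (zi2 a b c d)^* = zi2 a (- b) c (- d).
  rewrite /zi2 !(rmorphD, rmorphM) /= conjCi (CrealP sqrt2R) !conj_Creal ?Rreal_int ?realz //.
  by rewrite !rmorphN /=; ring.
have : (zi2 a b c d) * (zi2 a b c d)^* = 2 ^+ m.
  by rewrite -normCK -E normrM z1 mul1r normrX (ger0_norm _) ?sqrtC_ge0 ?ler0n // exprAC sqrt2K.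
rewrite conjE => nE.
have nE' : (a * a + b * b + 2 * (c * c) + 2 * (d * d) - 2 ^+ m)%:~R +
   sqrt2 * (2 * (a * c + b * d))%:~R = 0.
  rewrite !(rmorphD, rmorphB, rmorphM) rmorphN rmorphXn /= -nE /zi2 !rmorphN /=; ring: sqrt2K iK.
have [/eqP + /eqP] := sqrt2_irrational nE'.
rewrite subr_eq0 mulf_eq0 /= => /eqP n2 /eqP ac.
have [k kE] := omega_powers n2 ac; exists k.
have s0 : sqrt2 ^+ m != 0 by rewrite expf_neq0 ?sqrt2_neq0.
by apply: (mulIf s0); rewrite E kE mulrC.
Qed.

(** The modulus is 1 because every gate has fourth power 1, so the determinant, a power of u, is a
    root of unity. *)
Lemma scalar_circuit n (c : circuit n) u :
  circuit_mx C c = u%:M -> exists k, u = omega ^+ k.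
Proof.
move=> cE; apply: dyadic_norm1.
  pose x : bits n := [ffun=> false].
  have <- : circuit_mx C c (enum_rank x) (enum_rank x) = u by rewrite cE mxE eqxx.
  exact: dyadic_circuit.
have det4 : \det (circuit_mx C c) ^+ 4 = 1.
  elim: c {cE} => [|g c IH] /=; first by rewrite det1 expr1n.
  rewrite det_mulmx exprMn IH mul1r -(det1 C #|{: bits n}|) -(gate_mx_order4 C g).
  by rewrite !det_mulmx !exprS expr0 mulr1 !mulrA.
move/(congr1 Num.norm): det4; rewrite cE det_scalar normrX normr1 normrX -exprM => /eqP.
rewrite pexpr_eq1 ?normr_ge0 // => [/eqP//|].
by rewrite muln_gt0 card_bits expn_gt0.
Qed.

Lemma omega_circuit n (q : 'I_n) k : exists2 c : circuit n,
  all (fun g => ~~ is_two_qubit g) c & circuit_mx C c = (omega ^+ k)%:M.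
Proof.
elim: k => [|k [c cs cE]]; first by exists [::].
exists (c ++ [:: GateP q; GateH q; GateP q; GateH q; GateP q; GateH q]).
  by rewrite all_cat cs.
rewrite circuit_mx_cat cE exprS scalar_mxM /= mul1mx; congr (_ *m _).
rewrite !on_qubit_mul; apply: on_qubit_scal2 => a b.
rewrite /mul2 /hadamard /phase /scal2 omegaE sqrt2V.
by case: a b => [] []; rewrite /= ?expr0 ?expr1; field: sqrt2K iK.
Qed.

End GlobalPhase.

(** * Removing the signs by Pauli gates *)

Section PauliCorrection.
Variables (C : numClosedFieldType) (n : nat).
Implicit Types (M : 'Op[C]_n) (p : label n) (k q : 'I_n).

Definition commutes_upto M p (s : bool) :=
  M *m pauli C p = (-1) ^+ s *: (pauli C p *m M).

Lemma commutes_upto_mul M N p s s' : commutes_upto M p s -> commutes_upto N p s' ->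
  commutes_upto (M *m N) p (s (+) s').
Proof.
rewrite /commutes_upto => Ms Ns.
by rewrite -mulmxA Ns -scalemxAr [in LHS]mulmxA Ms -scalemxAl scalerA -mulmxA signr_addb mulrC.
Qed.

Lemma pauli_on_qubit k b : pauli C (pauli_at k b) = on_qubit k (pauli1 C b).
Proof.
rewrite on_qubit_tensor; apply: eq_tensor => r x y; rewrite ffunE /at_qubit.
by case: eqP => // _; rewrite /pauli1 addbF.
Qed.

(** Z = P^2 and X = H P^2 H. *)
Lemma pauli_circuit k b : exists2 c : circuit n,
  all (fun g => ~~ is_two_qubit g) c &
  forall p, commutes_upto (circuit_mx C c) p (symp (pauli_at k b) p).
Proof.
have mxZ : circuit_mx C [:: GateP k; GateP k] = pauli C (pauli_at k pZ).
  rewrite /= mul1mx on_qubit_mul pauli_on_qubit !on_qubit_tensor.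
  apply: eq_tensor => r x y; rewrite /at_qubit; case: eqP => // _.
  by rewrite phase_sqr /pauli1 addbF; case: x y => [] [].
have mxX : circuit_mx C [:: GateH k; GateP k; GateP k; GateH k] =
    pauli C (pauli_at k pX).
  rewrite /= mul1mx !on_qubit_mul pauli_on_qubit !on_qubit_tensor.
  apply: eq_tensor => r x y; rewrite /at_qubit; case: eqP => // _.
  have s2 := sqrtCK (2 : C); have i2 := sqrCi C.
  rewrite /mul2 /hadamard /phase /pauli1 sqrt2V.
  by case: x y => [] []; rewrite /= ?expr0 ?expr1; field: s2 i2.
exists ((if b.2 then [:: GateP k; GateP k] else [::]) ++
        (if b.1 then [:: GateH k; GateP k; GateP k; GateH k] else [::])).
  by case: b => [[] []].
move=> p; rewrite circuit_mx_cat symp_pauli_at.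
have id_comm : commutes_upto (circuit_mx C [::]) p false.
  by rewrite /commutes_upto /= scale1r mul1mx mulmx1.
apply: commutes_upto_mul; case: ifP => _ //.
  by rewrite mxX; have := pauli_comm C (pauli_at k pX) p; rewrite symp_pauli_at addbF.
by rewrite mxZ; have := pauli_comm C (pauli_at k pZ) p; rewrite symp_pauli_at.
Qed.

Lemma correct_signs (ks : seq 'I_n) M (sX sZ : 'I_n -> bool) :
    (forall k, commutes_upto M (pauli_at k pX) (sX k)) ->
    (forall k, commutes_upto M (pauli_at k pZ) (sZ k)) ->
    (forall k, sX k || sZ k -> k \in ks) ->
  exists c, [/\ all (fun g => ~~ is_two_qubit g) c,
    forall k, commutes_upto (circuit_mx C c *m M) (pauli_at k pX) false &
    forall k, commutes_upto (circuit_mx C c *m M) (pauli_at k pZ) false].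
Proof.
elim: ks M sX sZ => [|q ks IH] M sX sZ MX MZ sks.
  exists [::]; rewrite /= mul1mx; split=> // k.
    by have := MX k; have := sks k; rewrite in_nil; case: (sX k) => // /(_ isT).
  by have := MZ k; have := sks k; rewrite in_nil orbC; case: (sZ k) => // /(_ isT).
(* The bits are swapped: a wrong sign on X_q is repaired by Z_q, and one on Z_q by X_q. *)
have [d ds dP] := pauli_circuit q (sZ q, sX q).
have [|||c [cs cX cZ]] := IH (circuit_mx C d *m M)
    (fun k => symp (pauli_at q (sZ q, sX q)) (pauli_at k pX) (+) sX k)
    (fun k => symp (pauli_at q (sZ q, sX q)) (pauli_at k pZ) (+) sZ k).
- by move=> k; apply: commutes_upto_mul.
- by move=> k; apply: commutes_upto_mul.
- move=> k; rewrite !symp_pauli_at !ffunE (eq_sym q).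
  have := sks k; rewrite inE; case: (eqVneq k q) => [->|_] /=.
    by case: (sX q) (sZ q) => [] [].
  by rewrite !andbF.
exists (d ++ c); rewrite all_cat ds cs circuit_mx_cat -mulmxA.
by split.
Qed.

End PauliCorrection.

(** * Assembling synthesis, sign correction and phase correction *)

Theorem corollary7 (C : numClosedFieldType) (n : nat) (hn : (1 <= n)%N)
    (U : 'Op[C]_n) (hU : stabilizer_unitary U) :
  exists c : circuit n,
    [/\ circuit_mx C c = U, lnn c & two_qubit_depth_le c (14 * n - 4)%N].
Proof.
have [c0 c0U] := hU; have [d dU] := inverse_circuit C c0; rewrite c0U in dU.
have [w [wl wf wD]] := fix_qubits d; set M := circuit_mx C (d ++ w).
have M0 : M != 0.
  apply/eqP=> M0; have [e] := inverse_circuit C (d ++ w); rewrite -/M M0 mulmx0.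
  pose x : bits n := [ffun=> false].
  move/matrixP=> /(_ (enum_rank x) (enum_rank x)); rewrite !mxE eqxx => /eqP.
  by rewrite eq_sym oner_eq0.
have sign p : acts (d ++ w) p = p -> pauli C p *m pauli C p = 1%:M ->
    exists s, commutes_upto M p s.
  move=> pE p2; have [s _] := circuit_pauli C (d ++ w) p; rewrite pE -/M => E.
  (* Moving p past M twice multiplies by s^2, yet p squares to 1 and M is nonzero. *)
  have : s ^+ 2 == 1.
    have : s ^+ 2 *: M = M.
      rewrite -{2}[M]mulmx1 -p2 mulmxA E -scalemxAl -mulmxA E -scalemxAr scalerA.
      by rewrite mulmxA p2 mul1mx.
    by move/eqP; rewrite -subr_eq0 -{2}[M]scale1r -scalerBl scaler_eq0 (negPf M0) orbF subr_eq0.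
  by rewrite sqrf_eq1 => /orP[] /eqP s1; [exists false | exists true];
    rewrite /commutes_upto E s1.
have pauli2 k b : ~~ (b.1 && b.2) ->
    pauli C (pauli_at k b) *m pauli C (pauli_at k b) = 1%:M.
  move=> b0; rewrite pauli_on_qubit on_qubit_mul; apply: on_qubit_scal2 => x y.
  case: b b0 => [[] []] // _; rewrite /mul2 /pauli1 /scal2;
  by case: x y => [] []; rewrite /= ?expr0 ?expr1 ?(mulr0, mul0r, mulr1, addr0, add0r, mulrNN).
have /fin_all_exists[sX MX] k : exists s, commutes_upto M (pauli_at k pX) s.
  by apply: sign; [have [] := wf k | apply: pauli2].
have /fin_all_exists[sZ MZ] k : exists s, commutes_upto M (pauli_at k pZ) s.
  by apply: sign; [have [] := wf k | apply: pauli2].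
have [v [vs vX vZ]] := correct_signs MX MZ (fun k _ => mem_enum 'I_n k).
have [k|k|u vM] := @pauli_centralizer C n (circuit_mx C v *m M).
- by rewrite vX scale1r.
- by rewrite vZ scale1r.
have [k uE] : exists k, u = omega C ^+ k.
  by apply: (@scalar_circuit C n ((d ++ w) ++ v)); rewrite circuit_mx_cat.
(* Since omega^8 = 1, the power 7k cancels u = omega^k. *)
have [e es eE] := omega_circuit C (Ordinal hn) (7 * k).
have wvU : circuit_mx C (w ++ v) = u *: U.
  rewrite -mul_scalar_mx -vM /M !circuit_mx_cat -!mulmxA dU mulmx1.
  by [].
have ve1 : all (fun g => ~~ is_two_qubit g) (v ++ e) by rewrite all_cat vs.
have [|q|c [cE cl clay]] := @schedule C n (w ++ v ++ e) (10 * n - 1).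
- by rewrite lnn_cat wl single_lnn.
- by rewrite delays_cat delays_single //; have := wD q; lia.
(* 10n - 1 is at most 14n - 4 as soon as n is at least 1. *)
exists c; split=> //; last by exists (10 * n - 1)%N => //; lia.
rewrite cE catA circuit_mx_cat wvU eE mul_scalar_mx scalerA uE -exprD.
by rewrite -mulSnr exprM omega8 expr1n scale1r.
Qed.
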